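(* Let $k$ be a commutative ring with $1$ and let $(A,C)_\psi$ be an entwining structure over $k$. The forgetful functor $\mathbf{M}_A^C(\psi)\to\mathbf{M}_A$ is separable if and only if there exists a normalised integral map in $(A,C)_\psi$.
   Context: Algebras are associative unital $k$-algebras, coalgebras coassociative counital $k$-coalgebras, $\otimes=\otimes_k$; $\mu_A,1_A$ are product and unit, $\Delta_C(c)=c_{(1)}\otimes c_{(2)}$ and $\varepsilon_C$ coproduct and counit. An entwining structure $(A,C)_\psi$ is an algebra $A$, a coalgebra $C$ and a $k$-linear map $\psi:C\otimes A\to A\otimes C$, written $\psi(c\otimes a)=a_\alpha\otimes c^\alpha$ (summation understood), with $\psi\circ(C\otimes\mu_A)=(\mu_A\otimes C)\circ(A\otimes\psi)\circ(\psi\otimes A)$, $\psi\circ(C\otimes1_A)=1_A\otimes C$, $(A\otimes\Delta_C)\circ\psi=(\psi\otimes C)\circ(C\otimes\psi)\circ(\Delta_C\otimes A)$, $(A\otimes\varepsilon_C)\circ\psi=\varepsilon_C\otimes A$ (the name of a module also denotes its identity map). $\mathbf{M}_A$ is the category of right $A$-modules. $\mathbf{M}_A^C(\psi)$ is the category of entwined modules: right $A$-modules and right $C$-comodules $M$, with coaction $\rho^M(m)=m_{(0)}\otimes m_{(1)}$, such that $\rho^M(m\cdot a)=m_{(0)}\cdot a_\alpha\otimes m_{(1)}^\alpha$; morphisms are right $A$-linear right $C$-colinear maps. A covariant functor $F:\mathcal C\to\mathcal D$ is separable if the natural transformation $\mathrm{Hom}_{\mathcal C}(-,-)\to\mathrm{Hom}_{\mathcal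 D}(F(-),F(-))$ splits (has a natural left inverse). An integral map in $(A,C)_\psi$ is a $k$-linear map $\gamma:C\otimes C\to A$ such that $(\gamma\otimes C)\circ(C\otimes\Delta_C)=\psi\circ(C\otimes\gamma)\circ(\Delta_C\otimes C)$ and $\mu_A\circ(\gamma\otimes A)=\mu_A\circ(A\otimes\gamma)\circ(\psi\otimes C)\circ(C\otimes\psi)$. It is normalised if $\gamma(c_{(1)}\otimes c_{(2)})=\varepsilon_C(c)1_A$ for all $c\in C$. *)

(* Defs.v *)
From HB Require Import structures.
From mathcomp Require Import all_boot ssralg.
From mathcomp Require Import boolp.

Set Implicit Arguments.
Unset Strict Implicit.
Unset Printing Implicit Defensive.

Import GRing.Theory.
Local Open Scope ring_scope.
Local Open Scope quotient_scope.

(* The library's [lalgType], [algType] and [{bilinear _ -> _ -> _}] require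
   1 != 0 (in the algebra, resp. in the scalars).  Neither k nor an algebra is
   assumed nonzero here, so bilinearity and algebras are stated over an
   arbitrary [comPzRingType]. *)

Definition bilin (k : comPzRingType) (M N P : lmodType k) (f : M -> N -> P) :=
  (forall y, linear (f^~ y)) /\ (forall x, linear (f x)).

Section TensorProduct.
Variables (k : comPzRingType) (M N : lmodType k).

(* A sequence [:: (x1, y1); ...; (xn, yn)] stands for the formal sum of the
   symbols xi ⊗ yi; [tens_rel] is the congruence generated by commutativity
   and the defining relations of M ⊗ N. *)
Inductive tens_rel : seq (M * N) -> seq (M * N) -> Prop :=
| TensRefl s : tens_rel s s
| TensSym s t : tens_rel s t -> tens_rel t s
| TensTrans s t u : tens_rel s t -> tens_rel t u -> tens_rel s u
| TensCat s s' t t' :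
    tens_rel s s' -> tens_rel t t' -> tens_rel (s ++ t) (s' ++ t')
| TensCatC s t : tens_rel (s ++ t) (t ++ s)
| Tens0 y : tens_rel [:: (0, y)] [::]
| TensDl x x' y : tens_rel [:: (x + x', y)] [:: (x, y); (x', y)]
| TensDr x y y' : tens_rel [:: (x, y + y')] [:: (x, y); (x, y')]
| TensZ a x y : tens_rel [:: (a *: x, y)] [:: (x, a *: y)].

Definition tens_relb (s t : seq (M * N)) : bool := `[< tens_rel s t >].

Lemma tens_relb_refl : reflexive tens_relb.
Proof. by move=> s; apply/asboolP; apply: TensRefl. Qed.

Lemma tens_relb_sym : symmetric tens_relb.
Proof. by move=> s t; apply/asboolP/asboolP; apply: TensSym. Qed.

Lemma tens_relb_trans : transitive tens_relb.
Proof.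
move=> t s u /asboolP st /asboolP tu; apply/asboolP; exact: TensTrans st tu.
Qed.

Canonical tens_equiv :=
  EquivRel tens_relb tens_relb_refl tens_relb_sym tens_relb_trans.

Definition tensor := {eq_quot tens_equiv}.
HB.instance Definition _ := Choice.on tensor.
HB.instance Definition _ := Quotient.on tensor.

Implicit Types (s : seq (M * N)) (t u v : tensor).

Definition tens_class s : tensor := \pi_tensor s.

Lemma tens_classP s s' : tens_class s = tens_class s' <-> tens_rel s s'.
Proof.
split=> [st|st]; last by apply/(@eqmodP _ tens_equiv s s')/asboolP.
by apply/asboolP/(@eqmodP _ tens_equiv s s').
Qed.

Lemma tens_repr s : tens_rel (repr (tens_class s)) s.
Proof. by apply/tens_classP; rewrite /tens_class reprK. Qed.

Lemma tens_ind_class (Q : tensor -> Prop) :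
  (forall s, Q (tens_class s)) -> forall t, Q t.
Proof. by move=> Qc t; rewrite -[t]reprK; apply: Qc. Qed.

Definition tens_scale_seq (a : k) s := [seq (a *: p.1, p.2) | p <- s].

Lemma tens_rel_scale a s s' :
  tens_rel s s' -> tens_rel (tens_scale_seq a s) (tens_scale_seq a s').
Proof.
elim=> /= {s s'}.
- by move=> s; apply: TensRefl.
- by move=> s t _; apply: TensSym.
- by move=> s t u _ st _; apply: TensTrans.
- by move=> s s' t t' _ ss' _ tt'; rewrite /tens_scale_seq !map_cat; apply: TensCat.
- by move=> s t; rewrite /tens_scale_seq !map_cat; apply: TensCatC.
- by move=> y; rewrite /= scaler0; apply: Tens0.
- by move=> x x' y; rewrite /= scalerDr; apply: TensDl.
- by move=> x y y'; apply: TensDr.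
- by move=> b x y; rewrite /= scalerA mulrC -scalerA; apply: TensZ.
Qed.

Definition tens_add t u : tensor := tens_class (repr t ++ repr u).
Definition tens_scale a t : tensor := tens_class (tens_scale_seq a (repr t)).
Definition tens_opp t : tensor := tens_scale (- 1) t.

Lemma tens_addE s s' :
  tens_add (tens_class s) (tens_class s') = tens_class (s ++ s').
Proof. by apply/tens_classP/TensCat; apply: tens_repr. Qed.

Lemma tens_scaleE a s :
  tens_scale a (tens_class s) = tens_class (tens_scale_seq a s).
Proof. by apply/tens_classP/tens_rel_scale/tens_repr. Qed.

Lemma tens_addA : associative tens_add.
Proof.
elim/tens_ind_class=> s; elim/tens_ind_class=> t; elim/tens_ind_class=> u.
by rewrite !tens_addE catA.
Qed.

Lemma tens_addC : commutative tens_add.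
Proof.
elim/tens_ind_class=> s; elim/tens_ind_class=> t; rewrite !tens_addE.
by apply/tens_classP/TensCatC.
Qed.

Lemma tens_add0 : left_id (tens_class [::]) tens_add.
Proof. by elim/tens_ind_class=> s; rewrite tens_addE. Qed.

Lemma tens_scaleD t : {morph tens_scale^~ t : a b / a + b >-> tens_add a b}.
Proof.
elim/tens_ind_class: t => s a b; rewrite !tens_scaleE !tens_addE.
apply/tens_classP; elim: s => [|[x y] s IHs] /=; first exact: TensRefl.
rewrite scalerDl; apply: TensTrans (TensCat (TensDl _ _ _) IHs) _ => /=.
apply: (@TensCat [:: _] [:: _] _ _ (TensRefl _)).
rewrite -cat_rcons -cats1 -cat_cons; apply: TensCat (TensRefl _).
exact: (TensCatC [:: _]).
Qed.

Lemma tens_scale1 : left_id 1 tens_scale.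
Proof.
elim/tens_ind_class=> s; rewrite tens_scaleE; congr tens_class.
by rewrite -[RHS]map_id; apply: eq_map => -[x y] /=; rewrite scale1r.
Qed.

Lemma tens_scale0 t : tens_scale 0 t = tens_class [::].
Proof.
elim/tens_ind_class: t => s; rewrite tens_scaleE; apply/tens_classP.
elim: s => [|[x y] s IHs] /=; first exact: TensRefl.
by rewrite scale0r; apply: (TensCat (Tens0 y) IHs).
Qed.

Lemma tens_addN : left_inverse (tens_class [::]) tens_opp tens_add.
Proof. by move=> t; rewrite -{2}[t]tens_scale1 -tens_scaleD addNr tens_scale0. Qed.

HB.instance Definition _ :=
  GRing.isZmodule.Build tensor tens_addA tens_addC tens_add0 tens_addN.

Lemma tens_scaleA a b t : tens_scale a (tens_scale b t) = tens_scale (a * b) t.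
Proof.
elim/tens_ind_class: t => s; rewrite !tens_scaleE; congr tens_class.
by rewrite /tens_scale_seq -map_comp; apply: eq_map => p /=; rewrite scalerA.
Qed.

Lemma tens_scaleDr : right_distributive tens_scale tens_add.
Proof.
move=> a; elim/tens_ind_class=> s; elim/tens_ind_class=> t.
rewrite tens_addE !tens_scaleE tens_addE; congr tens_class.
by rewrite /tens_scale_seq map_cat.
Qed.

HB.instance Definition _ := GRing.Zmodule_isLmodule.Build k tensor
  tens_scaleA tens_scale1 tens_scaleDr tens_scaleD.

Lemma tens_classD s s' : tens_class s + tens_class s' = tens_class (s ++ s').
Proof. exact: tens_addE. Qed.

Lemma tens_classZ a s : a *: tens_class s = tens_class (tens_scale_seq a s).
Proof. exact: tens_scaleE. Qed.

Definition tens (x : M) (y : N) : tensor := tens_class [:: (x, y)].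

Lemma tens_bilin : bilin tens.
Proof.
split=> [y a x x'|x a y y']; rewrite /tens tens_classZ tens_classD.
  by apply/tens_classP/TensDl.
apply/tens_classP; apply: TensTrans (TensDr _ _ _) _.
by apply: (@TensCat [:: _] [:: _] [:: _] [:: _]) (TensRefl _); apply/TensSym/TensZ.
Qed.

Lemma tens_sum t : t = \sum_(p <- repr t) tens p.1 p.2.
Proof.
rewrite -[LHS]reprK -/(tens_class _); elim: (repr t) => [|[x y] s IHs].
  by rewrite big_nil.
by rewrite big_cons -IHs /tens tens_classD.
Qed.

Lemma tens_ind (Q : tensor -> Prop) : Q 0 ->
  (forall x y t, Q t -> Q (tens x y + t)) -> forall t, Q t.
Proof.
move=> Q0 QD t; rewrite [t]tens_sum; elim: (repr t) => [|p s IHs].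
  by rewrite big_nil.
by rewrite big_cons; apply: QD.
Qed.

Section Lift.
Variables (P : lmodType k) (f : M -> N -> P) (bf : bilin f).

Definition tlift of bilin f : tensor -> P :=
  fun t => \sum_(p <- repr t) f p.1 p.2.

Lemma tens_rel_sum s s' : tens_rel s s' ->
  \sum_(p <- s) f p.1 p.2 = \sum_(p <- s') f p.1 p.2.
Proof.
have [fl fr] := bf; elim=> {s s'} //=.
- by move=> s t u _ -> _ ->.
- by move=> s s' t t' _ ss' _ tt'; rewrite !big_cat /= ss' tt'.
- by move=> s t; rewrite !big_cat /= addrC.
- move=> y; rewrite big_seq1 big_nil /=.
  by have := fl y (- 1) 0 0; rewrite /= scaler0 addr0 scaleN1r addNr.
- move=> x x' y; rewrite !big_cons !big_nil !addr0 /=.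
  by have := fl y 1 x x'; rewrite /= !scale1r.
- move=> x y y'; rewrite !big_cons !big_nil !addr0 /=.
  by have := fr x 1 y y'; rewrite /= !scale1r.
- move=> a x y; rewrite !big_seq1 /=.
  have f0y : f 0 y = 0.
    by have := fl y (- 1) 0 0; rewrite /= scaler0 addr0 scaleN1r addNr.
  have fx0 : f x 0 = 0.
    by have := fr x (- 1) 0 0; rewrite /= scaler0 addr0 scaleN1r addNr.
  have := fl y a x 0; have := fr x a y 0.
  by rewrite /= f0y fx0 !addr0 => -> ->.
Qed.

Lemma tlift_class s : tlift bf (tens_class s) = \sum_(p <- s) f p.1 p.2.
Proof. exact/tens_rel_sum/tens_repr. Qed.

Lemma tliftE x y : tlift bf (tens x y) = f x y.
Proof. by rewrite tlift_class big_seq1. Qed.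

Lemma tlift_linear : linear (tlift bf).
Proof.
have [fl _] := bf.
move=> a; elim/tens_ind_class=> s; elim/tens_ind_class=> t.
rewrite tens_classZ tens_classD !tlift_class.
rewrite big_cat /= big_map scaler_sumr; congr (_ + _); apply: eq_bigr => p _ /=.
have f0y : f 0 p.2 = 0.
  by have := fl p.2 (- 1) 0 0; rewrite /= scaler0 addr0 scaleN1r addNr.
by have := fl p.2 a p.1 0; rewrite /= f0y !addr0.
Qed.

HB.instance Definition _ :=
  GRing.isLinear.Build k tensor P *:%R (tlift bf) tlift_linear.

End Lift.

Lemma tens_ext (P : lmodType k) (f g : {linear tensor -> P}) :
  (forall x y, f (tens x y) = g (tens x y)) -> f =1 g.
Proof.
move=> fg; elim/tens_ind=> [|x y t IHt]; first by rewrite !linear0.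
by rewrite !linearD fg IHt.
Qed.

Lemma tensor_universal (P : lmodType k) (f : M -> N -> P) : bilin f ->
  exists! g : tensor -> P, linear g /\ forall x y, g (tens x y) = f x y.
Proof.
move=> bf; exists (tlift bf); split; first by split; [exact: tlift_linear|exact: tliftE].
move=> g [glin gE]; apply/funext.
pose gL := HB.pack_for {linear tensor -> P} g
  (GRing.isLinear.Build k tensor P *:%R g glin).
by apply: (@tens_ext P (tlift bf) gL) => x y /=; rewrite tliftE gE.
Qed.

End TensorProduct.

Notation "M ⊗ N" := (tensor M N)
  (at level 40, left associativity) : type_scope.
Notation "x [⊗] y" := (tens x y)
  (at level 40, left associativity) : ring_scope.

Section TensorMaps.
Variable k : comPzRingType.

Section TensorMap.
Variables (M M' N N' : lmodType k).
Variables (f : {linear M -> M'}) (g : {linear N -> N'}).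

Lemma tmap_bilin : bilin (fun x y => f x [⊗] g y).
Proof.
have [tl tr] := @tens_bilin k M' N'.
by split=> [y a x x'|x a y y']; rewrite linearP ?tl ?tr.
Qed.

Definition tmap : {linear M ⊗ N -> M' ⊗ N'} := tlift tmap_bilin.

Lemma tmapE x y : tmap (x [⊗] y) = f x [⊗] g y.
Proof. exact: tliftE. Qed.

End TensorMap.

End TensorMaps.

Notation "f \⊗ g" := (tmap f g)
  (at level 40, left associativity) : ring_scope.
Notation "\id_ M" := (@idfun M%type : {linear M%type -> M%type})
  (at level 8, M at level 2, format "\id_ M") : ring_scope.

Section TensorMaps.
Variable k : comPzRingType.

Lemma tmap_id (M N : lmodType k) (t : M ⊗ N) : (\id_M \⊗ \id_N) t = t.
Proof.
by elim/tens_ind: t => [|x y t IHt]; rewrite ?linear0 // linearD tmapE IHt.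
Qed.

Lemma tmap_compl (M M' M'' N : lmodType k) (g : {linear M' -> M''})
    (f : {linear M -> M'}) (t : M ⊗ N) :
  ((g \o f : {linear M -> M''}) \⊗ \id_N) t = (g \⊗ \id_N) ((f \⊗ \id_N) t).
Proof.
elim/tens_ind: t => [|x y t IHt]; rewrite ?linear0 // !linearD IHt.
by rewrite !tmapE.
Qed.

Section Associator.
Variables (M N P : lmodType k).

Lemma tassoc_bilin1 (z : P) : bilin (fun (x : M) (y : N) => x [⊗] (y [⊗] z)).
Proof.
have [tl tr] := @tens_bilin k M (N ⊗ P); have [tl' _] := @tens_bilin k N P.
by split=> [y a x x'|x a y y']; rewrite /= ?tl // tl' tr.
Qed.

Lemma tassoc_bilin : bilin (fun (t : M ⊗ N) z => tlift (tassoc_bilin1 z) t).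
Proof.
have [_ tr] := @tens_bilin k M (N ⊗ P); have [_ tr'] := @tens_bilin k N P.
split=> [z a t t'|t a z z']; first exact: linearP.
rewrite /tlift scaler_sumr -big_split; apply: eq_bigr => p _ /=.
by rewrite tr' tr.
Qed.

Definition tassoc : {linear M ⊗ N ⊗ P -> M ⊗ (N ⊗ P)} :=
  tlift tassoc_bilin.

Lemma tassocE x y z : tassoc (x [⊗] y [⊗] z) = x [⊗] (y [⊗] z).
Proof. by rewrite [LHS](tliftE tassoc_bilin) tliftE. Qed.

Lemma tassocV_bilin1 (x : M) : bilin (fun (y : N) (z : P) => x [⊗] y [⊗] z).
Proof.
have [tl tr] := @tens_bilin k (M ⊗ N) P; have [_ tr'] := @tens_bilin k M N.
by split=> [z a y y'|y a z z']; rewrite /= ?tr // tr' tl.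
Qed.

Lemma tassocV_bilin : bilin (fun x (t : N ⊗ P) => tlift (tassocV_bilin1 x) t).
Proof.
have [tl _] := @tens_bilin k (M ⊗ N) P; have [tl' _] := @tens_bilin k M N.
split=> [t a x x'|x a t t']; last exact: linearP.
rewrite /tlift scaler_sumr -big_split; apply: eq_bigr => p _ /=.
by rewrite tl' tl.
Qed.

Definition tassocV : {linear M ⊗ (N ⊗ P) -> M ⊗ N ⊗ P} :=
  tlift tassocV_bilin.

Lemma tassocVE x y z : tassocV (x [⊗] (y [⊗] z)) = x [⊗] y [⊗] z.
Proof. by rewrite [LHS](tliftE tassocV_bilin) tliftE. Qed.

End Associator.

Section Unitors.
Variable M : lmodType k.

Lemma tunitl_bilin : bilin (fun (a : k^o) (x : M) => a *: x).
Proof.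
split=> [x b a a'|a b x x'] /=; first by rewrite scalerDl -scalerA.
by rewrite scalerDr !scalerA mulrC.
Qed.

Definition tunitl : {linear k^o ⊗ M -> M} := tlift tunitl_bilin.

Lemma tunitlE (a : k^o) x : tunitl (a [⊗] x) = (a : k) *: x.
Proof. exact: (tliftE tunitl_bilin). Qed.

Lemma tunitr_bilin : bilin (fun (x : M) (a : k^o) => a *: x).
Proof. by have [? ?] := tunitl_bilin; split. Qed.

Definition tunitr : {linear M ⊗ k^o -> M} := tlift tunitr_bilin.

Lemma tunitrE x (a : k^o) : tunitr (x [⊗] a) = (a : k) *: x.
Proof. exact: (tliftE tunitr_bilin). Qed.

End Unitors.

End TensorMaps.

Arguments tassoc {k M N P}.
Arguments tassocV {k M N P}.
Arguments tunitl {k M}.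
Arguments tunitr {k M}.

Record algebra (k : comPzRingType) := Algebra {
  alg_mod :> lmodType k;
  amul : {linear alg_mod ⊗ alg_mod -> alg_mod};
  aone : alg_mod;
  amulA : forall a b c, amul (a [⊗] amul (b [⊗] c)) = amul (amul (a [⊗] b) [⊗] c);
  amul1l : forall a, amul (aone [⊗] a) = a;
  amul1r : forall a, amul (a [⊗] aone) = a }.

Arguments amul {k} _.
Arguments aone {k} _.

Record coalgebra (k : comPzRingType) := Coalgebra {
  coalg_mod :> lmodType k;
  comul : {linear coalg_mod -> coalg_mod ⊗ coalg_mod};
  counit : {linear coalg_mod -> k^o};
  comulA : forall c,
    tassoc ((comul \⊗ \id_coalg_mod) (comul c)) = (\id_coalg_mod \⊗ comul) (comul c);
  counitl : forall c, tunitl ((counit \⊗ \id_coalg_mod) (comul c)) = c;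
  counitr : forall c, tunitr ((\id_coalg_mod \⊗ counit) (comul c)) = c }.

Arguments comul {k} _.
Arguments counit {k} _.

(* Composites are written on elements of the source, with the associativity
   and unit isomorphisms explicit. *)
Record entwining (k : comPzRingType) (A : algebra k) (C : coalgebra k) :=
  Entwining {
  entw_map :> {linear C ⊗ A -> A ⊗ C};
  entw_mul : forall t : C ⊗ A ⊗ A,
    entw_map ((\id_C \⊗ amul A) (tassoc t)) =
    (amul A \⊗ \id_C) (tassocV ((\id_A \⊗ entw_map) (tassoc ((entw_map \⊗ \id_A) t))));
  entw_one : forall c : C, entw_map (c [⊗] aone A) = aone A [⊗] c;
  entw_comul : forall t : C ⊗ A,
    (\id_A \⊗ comul C) (entw_map t) =
    tassoc ((entw_map \⊗ \id_C) (tassocV ((\id_C \⊗ entw_map)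
      (tassoc ((comul C \⊗ \id_A) t)))));
  entw_counit : forall t : C ⊗ A,
    tunitr ((\id_A \⊗ counit C) (entw_map t)) = tunitl ((counit C \⊗ \id_A) t) }.

Section IntegralMaps.
Variables (k : comPzRingType) (A : algebra k) (C : coalgebra k).
Variable psi : entwining A C.

Definition integral_map (gamma : {linear C ⊗ C -> A}) : Prop :=
  (forall t : C ⊗ C,
     (gamma \⊗ \id_C) (tassocV ((\id_C \⊗ comul C) t)) =
     psi ((\id_C \⊗ gamma) (tassoc ((comul C \⊗ \id_C) t)))) /\
  (forall t : C ⊗ C ⊗ A,
     amul A ((gamma \⊗ \id_A) t) =
     amul A ((\id_A \⊗ gamma) (tassoc ((psi \⊗ \id_C)
       (tassocV ((\id_C \⊗ psi) (tassoc t))))))).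

Definition normalised (gamma : {linear C ⊗ C -> A}) : Prop :=
  forall c : C, gamma (comul C c) = (counit C c : k) *: aone A.

End IntegralMaps.

Record category := Category {
  obj :> Type;
  Hom : obj -> obj -> Type;
  cid : forall X, Hom X X;
  ccomp : forall X Y Z, Hom Y Z -> Hom X Y -> Hom X Z;
  ccompA : forall X Y Z W (h : Hom Z W) (g : Hom Y Z) (f : Hom X Y),
    ccomp h (ccomp g f) = ccomp (ccomp h g) f;
  ccomp1l : forall X Y (f : Hom X Y), ccomp (cid Y) f = f;
  ccomp1r : forall X Y (f : Hom X Y), ccomp f (cid X) = f }.

Arguments Hom {c} X Y.
Arguments cid {c} X.
Arguments ccomp {c X Y Z} g f.

Record functor (C D : category) := Functor {
  fobj :> C -> D;
  fmap : forall X Y : C, Hom X Y -> Hom (fobj X) (fobj Y);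
  fmap1 : forall X, fmap (cid X) = cid (fobj X);
  fmap_comp : forall (X Y Z : C) (g : Hom Y Z) (f : Hom X Y),
    fmap (ccomp g f) = ccomp (fmap g) (fmap f) }.

Arguments fmap {C D} f {X Y} _ : rename.

(* P is a transformation Hom_D(F -, F -) -> Hom_C(-, -), natural in both
   variables, left inverse to Hom_C(-, -) -> Hom_D(F -, F -). *)
Definition separable (C D : category) (F : functor C D) : Prop :=
  exists P : forall X Y : C, Hom (F X) (F Y) -> Hom X Y,
    (forall (X X' Y Y' : C) (f : Hom X' X) (g : Hom Y Y') (u : Hom (F X) (F Y)),
       P X' Y' (ccomp (fmap F g) (ccomp u (fmap F f))) =
       ccomp g (ccomp (P X Y u) f)) /\
    (forall (X Y : C) (f : Hom X Y), P X Y (fmap F f) = f).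

Lemma linear_ext (k : comPzRingType) (M N : lmodType k) (f g : {linear M -> N}) :
  f =1 g -> f = g.
Proof.
move=> /funext; case: f g => [f [[fa] [fs]]] [g [[ga] [gs]]] /= fg.
case: _ / fg in ga gs *.
by rewrite (Prop_irrelevance fa ga) (Prop_irrelevance fs gs).
Qed.

Section RightModules.
Variables (k : comPzRingType) (A : algebra k).

Record rmodule := RModule {
  rmod :> lmodType k;
  ract : {linear rmod ⊗ A -> rmod};
  ractA : forall m a b,
    ract (ract (m [⊗] a) [⊗] b) = ract (m [⊗] amul A (a [⊗] b));
  ract1 : forall m, ract (m [⊗] aone A) = m }.

Record rmod_hom (M N : rmodule) := RmodHom {
  rmod_fun :> {linear M -> N};
  rmod_funP : forall m a, rmod_fun (ract M (m [⊗] a)) = ract N (rmod_fun m [⊗] a) }.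

Lemma rmod_hom_ext (M N : rmodule) (f g : rmod_hom M N) : f =1 g -> f = g.
Proof.
move=> /linear_ext; case: f g => [f fP] [g gP] /= fg.
by case: _ / fg in gP *; rewrite (Prop_irrelevance fP gP).
Qed.

Lemma rmod_idP (M : rmodule) m a : \id_M (ract M (m [⊗] a)) = ract M (\id_M m [⊗] a).
Proof. by []. Qed.

Definition rmod_id (M : rmodule) : rmod_hom M M := RmodHom (@rmod_idP M).

Section Comp.
Variables (M N P : rmodule) (g : rmod_hom N P) (f : rmod_hom M N).

Lemma rmod_compP m a :
  (g \o f) (ract M (m [⊗] a)) = ract P ((g \o f) m [⊗] a).
Proof. by rewrite /= !rmod_funP. Qed.

Definition rmod_comp : rmod_hom M P :=
  @RmodHom M P (g \o f : {linear M -> P}) rmod_compP.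

End Comp.

Definition Mod : category.
Proof.
refine (@Category rmodule rmod_hom rmod_id rmod_comp _ _ _) => *;
  exact: rmod_hom_ext.
Defined.

End RightModules.

Section EntwinedModules.
Variables (k : comPzRingType) (A : algebra k) (C : coalgebra k).
Variable psi : entwining A C.

Record ent_module := EntModule {
  ent_rmod :> rmodule A;
  rcoact : {linear ent_rmod -> ent_rmod ⊗ C};
  rcoactA : forall m,
    tassoc ((rcoact \⊗ \id_C) (rcoact m)) = (\id_ent_rmod \⊗ comul C) (rcoact m);
  rcoact1 : forall m, tunitr ((\id_ent_rmod \⊗ counit C) (rcoact m)) = m;
  rcoact_psi : forall m (a : A),
    rcoact (ract ent_rmod (m [⊗] a)) =
    (ract ent_rmod \⊗ \id_C) (tassocV ((\id_ent_rmod \⊗ psi)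
      (tassoc (rcoact m [⊗] a)))) }.

Record ent_hom (M N : ent_module) := EntHom {
  ent_fun :> rmod_hom M N;
  ent_funP : forall m, rcoact N (ent_fun m) = (ent_fun \⊗ \id_C) (rcoact M m) }.

Lemma ent_hom_ext (M N : ent_module) (f g : ent_hom M N) : f =1 g -> f = g.
Proof.
move=> /rmod_hom_ext; case: f g => [f fP] [g gP] /= fg.
by case: _ / fg in gP *; rewrite (Prop_irrelevance fP gP).
Qed.

Lemma ent_idP (M : ent_module) m :
  rcoact M (rmod_id M m) = (rmod_id M \⊗ \id_C) (rcoact M m).
Proof. by rewrite tmap_id. Qed.

Definition ent_id (M : ent_module) : ent_hom M M := EntHom (@ent_idP M).

Section Comp.
Variables (M N P : ent_module) (g : ent_hom N P) (f : ent_hom M N).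

Lemma ent_compP m :
  rcoact P (rmod_comp g f m) = (rmod_comp g f \⊗ \id_C) (rcoact M m).
Proof. by rewrite tmap_compl /= !ent_funP. Qed.

Definition ent_comp : ent_hom M P := EntHom ent_compP.

End Comp.

Definition EntMod : category.
Proof.
refine (@Category ent_module ent_hom ent_id ent_comp _ _ _) => *;
  exact: ent_hom_ext.
Defined.

Definition forgetful : functor EntMod (Mod A).
Proof.
refine (@Functor EntMod (Mod A) ent_rmod ent_fun _ _) => *; exact: rmod_hom_ext.
Defined.

End EntwinedModules.

(* Main.v *)
From HB Require Import structures.
Require Import Defs.
From mathcomp Require Import all_boot ssralg.

Set Implicit Arguments.
Unset Strict Implicit.
Unset Printing Implicit Defensive.

Import GRing.Theory.
Local Open Scope ring_scope.

(** For an entwined module N the coaction N -> N ⊗ C is the unit of an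
    adjunction: the forgetful functor to right A-modules is left adjoint to
    the functor sending an A-module N to N ⊗ C, with action
    (n ⊗ c) a = n a_α ⊗ c^α and coaction through Δ, and the counit is
    N ⊗ ε : N ⊗ C -> N.  A left adjoint is separable exactly when its unit has
    a natural retraction.  So the forgetful functor is separable if and only if
    there are morphisms of entwined modules ν_N : N ⊗ C -> N, natural in N, with
    ν_N(n_(0) ⊗ n_(1)) = n ([separable_retraction]).  It remains to match such
    ν with normalised integral maps γ.

    From γ to ν: put ν_N(n ⊗ c) = n_(0) γ(n_(1) ⊗ c).  The first integral
    condition makes ν_N colinear, the second makes it A-linear, and
    normalisation makes it a retraction of the coaction
    ([integral_retraction_linear], [integral_retraction_colinear],
    [integral_retraction_natural]).

    From ν to γ: put θ(c ⊗ d) = ν_(A ⊗ C)(1 ⊗ c ⊗ d) in A ⊗ C and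
    γ = (A ⊗ ε) θ.  Naturality of ν under the maps N ⊗ C -> N' ⊗ C coming from
    A-linear maps N -> N' gives ν_(A ⊗ C)(a ⊗ c ⊗ d) = a θ(c ⊗ d), which together
    with A-linearity of ν yields the second integral condition.  For the first,
    θ is computed twice.  Colinearity of ν gives θ(c ⊗ d) = γ(c ⊗ d_(1)) ⊗ d_(2)
    ([nu_unit_colinear]).  On the other hand C ⊗ A is an entwined module, and
    both its coaction and ψ : C ⊗ A -> A ⊗ C are morphisms of entwined modules;
    naturality under the coaction gives
    ν_(C ⊗ A)(c ⊗ 1 ⊗ d) = c_(1) ⊗ γ(c_(2) ⊗ d) ([nu_free_entwined]), and
    naturality under ψ turns this into θ(c ⊗ d) = ψ(c_(1) ⊗ γ(c_(2) ⊗ d))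
    ([nu_unit_entw]). *)

(** * Calculus with tensors *)

Section TensorCalculus.
Variables (k : comPzRingType) (M N : lmodType k).
Implicit Types (x : M) (y : N).

Lemma tensDl x x' y : (x + x') [⊗] y = x [⊗] y + x' [⊗] y.
Proof. by have := (tens_bilin M N).1 y 1 x x'; rewrite /= !scale1r. Qed.

Lemma tensDr x y y' : x [⊗] (y + y') = x [⊗] y + x [⊗] y'.
Proof. by have := (tens_bilin M N).2 x 1 y y'; rewrite /= !scale1r. Qed.

Lemma tens0l y : (0 : M) [⊗] y = 0.
Proof. by apply: (addIr (0 [⊗] y)); rewrite -tensDl !add0r. Qed.

Lemma tens0r x : x [⊗] (0 : N) = 0.
Proof. by apply: (addIr (x [⊗] 0)); rewrite -tensDr !add0r. Qed.

Lemma tensZl a x y : (a *: x) [⊗] y = a *: (x [⊗] y).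
Proof.
by have := (tens_bilin M N).1 y a x 0; rewrite /= tens0l !addr0.
Qed.

Lemma tensZr a x y : x [⊗] (a *: y) = a *: (x [⊗] y).
Proof.
by have := (tens_bilin M N).2 x a y 0; rewrite /= tens0r !addr0.
Qed.

End TensorCalculus.

Lemma lin_compE (k : comPzRingType) (M N P : lmodType k)
    (g : {linear N -> P}) (f : {linear M -> N}) x :
  (g \o f : {linear M -> P}) x = g (f x).
Proof. by []. Qed.

(** [lin_compE] also matches a named linear map whose body is a composite, so
    rewriting with [tensE] opens such names on the way. *)
Definition tensE := (tmapE, tassocE, tassocVE, tunitlE, tunitrE, lin_compE).

(** Sweedler notation as a proof step: both sides of an identity that are
    linear in t may be compared with t replaced by a pure tensor x ⊗ y.  In
    particular, after [move: (comul C c) => t], the step [sweedler t c1 c2] is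
    the licence to write Δ(c) as c1 ⊗ c2. *)
Ltac sweedler t x y :=
  let IH := fresh in
  elim/tens_ind: t => [|x y ? IH];
  [ by rewrite ?(tens0l, tens0r, linear0)
  | rewrite !(tensDl, tensDr, linearD); congr (_ + _); [clear IH | exact: IH]].

Lemma tassocK (k : comPzRingType) (M N P : lmodType k) :
  cancel (@tassoc k M N P) tassocV.
Proof.
move=> t; sweedler t u z; rewrite ?tensE.
by sweedler u x y; rewrite !tensE.
Qed.

(** * Free and cofree modules *)

Section Modules.
Variables (k : comPzRingType) (A : algebra k).

Definition regular : rmodule A :=
  RModule (fun m a b => esym (amulA m a b)) (@amul1r k A).

Section Free.
Variable V : lmodType k.

Definition free_act : {linear (V ⊗ A) ⊗ A -> V ⊗ A} :=
  (\id_V \⊗ amul A) \o tassoc.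

Lemma free_actA (m : V ⊗ A) a b :
  free_act (free_act (m [⊗] a) [⊗] b) = free_act (m [⊗] amul A (a [⊗] b)).
Proof. by rewrite /free_act !tensE; sweedler m v c; rewrite !tensE amulA. Qed.

Lemma free_act1 (m : V ⊗ A) : free_act (m [⊗] aone A) = m.
Proof. by rewrite /free_act !tensE; sweedler m v c; rewrite !tensE amul1r. Qed.

Definition free : rmodule A := RModule free_actA free_act1.

End Free.

End Modules.

Section Entwined.
Variables (k : comPzRingType) (A : algebra k) (C : coalgebra k).
Variable psi : entwining A C.

Section Cofree.
Variable N : rmodule A.

(** (n ⊗ c) a = n a_α ⊗ c^α. *)
Definition cofree_act : {linear (N ⊗ C) ⊗ A -> N ⊗ C} :=
  (ract N \⊗ \id_C) \o tassocV \o (\id_N \⊗ psi) \o tassoc.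

Lemma cofree_actA (t : N ⊗ C) a b :
  cofree_act (cofree_act (t [⊗] a) [⊗] b) =
  cofree_act (t [⊗] amul A (a [⊗] b)).
Proof.
rewrite /cofree_act !tensE; sweedler t n c; rewrite !tensE.
have := entw_mul psi (c [⊗] a [⊗] b); rewrite !tensE => ->.
move: (psi (c [⊗] a)) => t; sweedler t a' c'; rewrite !tensE.
move: (psi (c' [⊗] b)) => t; sweedler t b' c''.
by rewrite !tensE ractA.
Qed.

Lemma cofree_act1 (t : N ⊗ C) : cofree_act (t [⊗] aone A) = t.
Proof.
rewrite /cofree_act !tensE; sweedler t n c.
by rewrite !tensE entw_one !tensE ract1.
Qed.

Definition cofree_rmod : rmodule A := RModule cofree_actA cofree_act1.

Definition cofree_coact : {linear N ⊗ C -> N ⊗ C ⊗ C} :=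
  tassocV \o (\id_N \⊗ comul C).

Lemma cofree_coactA t :
  tassoc ((cofree_coact \⊗ \id_C) (cofree_coact t)) =
  (\id_(N ⊗ C) \⊗ comul C) (cofree_coact t).
Proof.
rewrite {2 3}/cofree_coact !tensE; sweedler t n c; rewrite !tensE.
transitivity (tassocV (n [⊗] tassoc ((comul C \⊗ \id_C) (comul C c)))).
  move: (comul C c) => t; sweedler t c1 c2.
  rewrite !tensE.
  move: (comul C c1) => t; sweedler t c3 c4.
  by rewrite !tensE.
rewrite comulA; move: (comul C c) => t; sweedler t c1 c2.
by rewrite !tensE.
Qed.

Lemma cofree_coact1 t : tunitr ((\id_(N ⊗ C) \⊗ counit C) (cofree_coact t)) = t.
Proof.
rewrite /cofree_coact !tensE; sweedler t n c; rewrite !tensE -[in RHS](counitr c).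
move: (comul C c) => t; sweedler t c1 c2.
by rewrite !tensE tensZr.
Qed.

(** The compatibility of the coaction N ⊗ Δ with the twisted action is the axiom
    (A ⊗ Δ) ψ = (ψ ⊗ C)(C ⊗ ψ)(Δ ⊗ A), applied to the C ⊗ A part. *)
Lemma cofree_coact_psi t a :
  cofree_coact (cofree_act (t [⊗] a)) =
  (cofree_act \⊗ \id_C) (tassocV ((\id_(N ⊗ C) \⊗ psi)
    (tassoc (cofree_coact t [⊗] a)))).
Proof.
rewrite /cofree_coact {1}/cofree_act !tensE; sweedler t n c; rewrite !tensE.
transitivity ((ract N \⊗ \id_C \⊗ \id_C) (tassocV (tassocV
   (n [⊗] (\id_A \⊗ comul C) (psi (c [⊗] a)))))).
  move: (psi (c [⊗] a)) => t; sweedler t a' c'; rewrite !tensE.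
  move: (comul C c') => t; sweedler t c1 c2.
  by rewrite !tensE.
rewrite entw_comul !tensE.
move: (comul C c) => t; sweedler t c1 c2; rewrite !tensE.
move: (psi (c2 [⊗] a)) => t; sweedler t a' c'; rewrite !tensE.
move: (psi (c1 [⊗] a')) => t; sweedler t a'' c''.
by rewrite !tensE.
Qed.

(** The right adjoint of the forgetful functor, on objects. *)
Definition cofree : ent_module psi :=
  @EntModule k A C psi cofree_rmod cofree_coact
    cofree_coactA cofree_coact1 cofree_coact_psi.

End Cofree.

Lemma ract_cofreeE (N : rmodule A) : ract (cofree N) = cofree_act N.
Proof. by []. Qed.

Lemma rcoact_cofreeE (N : rmodule A) : rcoact (cofree N) = cofree_coact N.
Proof. by []. Qed.

Section Counit.
Variable N : rmodule A.

Definition cofree_eps_map : {linear N ⊗ C -> N} :=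
  tunitr \o (\id_N \⊗ counit C).

Lemma cofree_eps_linear t a :
  cofree_eps_map (ract (cofree N) (t [⊗] a)) = ract N (cofree_eps_map t [⊗] a).
Proof.
rewrite ract_cofreeE /cofree_eps_map /cofree_act !tensE.
sweedler t n c; rewrite !tensE.
transitivity (ract N (n [⊗] tunitr ((\id_A \⊗ counit C) (psi (c [⊗] a))))).
  move: (psi (c [⊗] a)) => t; sweedler t a' c'.
  by rewrite !tensE tensZr linearZ_LR.
by rewrite entw_counit !tensE tensZr tensZl.
Qed.

(** The counit of the adjunction. *)
Definition cofree_eps : rmod_hom (cofree N) N :=
  @RmodHom k A (cofree N) N cofree_eps_map cofree_eps_linear.

End Counit.

Section CofreeMap.
Variables (M N : rmodule A) (f : rmod_hom M N).

Lemma cofree_map_linear t a :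
  (f \⊗ \id_C) (ract (cofree M) (t [⊗] a)) =
  ract (cofree N) ((f \⊗ \id_C) t [⊗] a).
Proof.
rewrite !ract_cofreeE /cofree_act !tensE; sweedler t m c; rewrite !tensE.
move: (psi (c [⊗] a)) => t; sweedler t a' c'.
by rewrite !tensE rmod_funP.
Qed.

Definition cofree_map_rmod : rmod_hom (cofree M) (cofree N) :=
  @RmodHom k A (cofree M) (cofree N) (f \⊗ \id_C) cofree_map_linear.

Lemma cofree_map_colinear t :
  rcoact (cofree N) ((f \⊗ \id_C) t) =
  (f \⊗ \id_C \⊗ \id_C) (rcoact (cofree M) t).
Proof.
rewrite !rcoact_cofreeE /cofree_coact !tensE; sweedler t m c; rewrite !tensE.
move: (comul C c) => t; sweedler t c1 c2.
by rewrite !tensE.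
Qed.

Definition cofree_map : ent_hom (cofree M) (cofree N) :=
  @EntHom k A C psi (cofree M) (cofree N) cofree_map_rmod cofree_map_colinear.

End CofreeMap.

Section CoactHom.
Variable M : ent_module psi.

Lemma coact_linear m a :
  rcoact M (ract M (m [⊗] a)) = ract (cofree M) (rcoact M m [⊗] a).
Proof. by rewrite rcoact_psi ract_cofreeE /cofree_act !tensE. Qed.

Definition coact_rmod_hom : rmod_hom M (cofree M) :=
  @RmodHom k A M (cofree M) (rcoact M) coact_linear.

Lemma coact_colinear m :
  rcoact (cofree M) (rcoact M m) = (rcoact M \⊗ \id_C) (rcoact M m).
Proof.
rewrite rcoact_cofreeE /cofree_coact !tensE -rcoactA.
move: (rcoact M m) => t; sweedler t m' c; rewrite !tensE /=.
move: (rcoact M m') => t; sweedler t m'' c'.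
by rewrite !tensE.
Qed.

(** The unit of the adjunction. *)
Definition coact_hom : ent_hom M (cofree M) :=
  @EntHom k A C psi M (cofree M) coact_rmod_hom coact_colinear.

End CoactHom.

(** * The entwined module C ⊗ A *)

Section FreeOnC.

Lemma ract_freeE V : ract (free A V) = free_act A V.
Proof. by []. Qed.

(** c ⊗ a goes to c_(1) ⊗ a_α ⊗ c_(2)^α. *)
Definition free_coact : {linear C ⊗ A -> C ⊗ A ⊗ C} :=
  tassocV \o (\id_C \⊗ psi) \o tassoc \o (comul C \⊗ \id_A).

Lemma free_coactA t :
  tassoc ((free_coact \⊗ \id_C) (free_coact t)) =
  (\id_(C ⊗ A) \⊗ comul C) (free_coact t).
Proof.
rewrite {2 3}/free_coact !tensE; sweedler t c a; rewrite !tensE.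
(* Both sides equal c_(1) ⊗ psi2 (c_(2) ⊗ c_(3) ⊗ a), where psi2 carries a
   leftwards past two elements of C: on the left by reading Δ(c_(1)) ⊗ c_(2), on
   the right by the compatibility of ψ with Δ. *)
pose psi1 : {linear C ⊗ (A ⊗ C) -> A ⊗ (C ⊗ C)} :=
  tassoc \o (psi \⊗ \id_C) \o tassocV.
pose psi2 : {linear C ⊗ C ⊗ A -> A ⊗ (C ⊗ C)} :=
  psi1 \o (\id_C \⊗ psi) \o tassoc.
transitivity (tassocV ((\id_C \⊗ psi2)
    (tassoc (tassoc ((comul C \⊗ \id_C) (comul C c)) [⊗] a)))).
  move: (comul C c) => t; sweedler t c1 c2; rewrite !tensE.
  transitivity (tassocV ((\id_C \⊗ psi1)
      (tassoc (comul C c1 [⊗] psi (c2 [⊗] a))))).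
    move: (psi _) => t; sweedler t a' c'; rewrite /free_coact !tensE.
    move: (comul C c1) => t; sweedler t c3 c4; rewrite /psi1 !tensE.
    move: (psi _) => t; sweedler t a'' c''.
    by rewrite !tensE.
  move: (comul C c1) => t; sweedler t c3 c4.
  by rewrite /psi2 !tensE.
rewrite comulA.
move: (comul C c) => t; sweedler t c1 c2; rewrite !tensE.
transitivity (tassocV (c1 [⊗] (\id_A \⊗ comul C) (psi (c2 [⊗] a)))).
  by rewrite entw_comul !tensE.
move: (psi _) => t; sweedler t a' c'.
by rewrite !tensE.
Qed.

Lemma free_coact1 t : tunitr ((\id_(C ⊗ A) \⊗ counit C) (free_coact t)) = t.
Proof.
rewrite /free_coact !tensE; sweedler t c a; rewrite !tensE -[in RHS](counitr c).
move: (comul C c) => t; sweedler t c1 c2; rewrite !tensE.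
transitivity (c1 [⊗] tunitr ((\id_A \⊗ counit C) (psi (c2 [⊗] a)))).
  move: (psi _) => t; sweedler t a' c'.
  by rewrite !tensE tensZr.
by rewrite entw_counit !tensE tensZr tensZl.
Qed.

Lemma free_coact_psi (t : C ⊗ A) a :
  free_coact (ract (free A C) (t [⊗] a)) =
  (ract (free A C) \⊗ \id_C) (tassocV ((\id_(C ⊗ A) \⊗ psi)
    (tassoc (free_coact t [⊗] a)))).
Proof.
rewrite ract_freeE /free_coact {1}/free_act !tensE.
sweedler t c b; rewrite !tensE.
move: (comul C c) => t; sweedler t c1 c2; rewrite !tensE.
have := entw_mul psi (c2 [⊗] b [⊗] a); rewrite !tensE => ->.
move: (psi _) => t; sweedler t a' c'; rewrite !tensE.
move: (psi _) => t; sweedler t a'' c''.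
by rewrite /free_act !tensE.
Qed.

Definition free_entwined : ent_module psi :=
  @EntModule k A C psi (free A C) free_coact
    free_coactA free_coact1 free_coact_psi.

Lemma rcoact_freeE : rcoact free_entwined = free_coact.
Proof. by []. Qed.

Lemma entw_linear (t : C ⊗ A) a :
  psi (ract free_entwined (t [⊗] a)) = ract (cofree (regular A)) (psi t [⊗] a).
Proof.
rewrite ract_cofreeE ract_freeE /cofree_act /free_act !tensE; sweedler t c b.
by have := entw_mul psi (c [⊗] b [⊗] a); rewrite !tensE.
Qed.

Definition entw_rmod_hom : rmod_hom free_entwined (cofree (regular A)) :=
  @RmodHom k A free_entwined (cofree (regular A)) psi entw_linear.

Lemma entw_colinear (t : C ⊗ A) :
  rcoact (cofree (regular A)) (psi t) = (psi \⊗ \id_C) (rcoact free_entwined t).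
Proof.
rewrite rcoact_cofreeE /cofree_coact rcoact_freeE /free_coact !tensE.
by rewrite entw_comul tassocK.
Qed.

(** ψ is a morphism C ⊗ A -> A ⊗ C of entwined modules: its A-linearity is the
    axiom on products and its colinearity the axiom on coproducts. *)
Definition entw_hom : ent_hom free_entwined (cofree (regular A)) :=
  @EntHom k A C psi free_entwined (cofree (regular A)) entw_rmod_hom entw_colinear.

End FreeOnC.

(** * Separability as a natural retraction of the coaction *)

Definition natural_retraction
    (nu : forall N : ent_module psi, ent_hom (cofree N) N) :=
  (forall (M N : ent_module psi) (f : ent_hom M N) t,
     f (nu M t) = nu N ((f \⊗ \id_C) t)) /\
  (forall (N : ent_module psi) n, nu N (rcoact N n) = n).

(** Rafael's criterion for this adjunction.  A natural splitting P of the action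
    on morphisms, applied to the counits, gives ν_N = P(N ⊗ ε); conversely ν
    gives P(u) = ν_N (u ⊗ C) ρ for A-linear u with target N. *)
Lemma separable_retraction : separable (forgetful psi) <->
  exists nu, natural_retraction nu.
Proof.
split=> [[P [Pnat PK]]|[nu [nu_nat nuK]]].
  (* Naturality of P in terms of commuting squares of A-linear maps, on elements. *)
  have PnatE (X X' Y Y' : ent_module psi) (f : ent_hom X' X) (g : ent_hom Y Y')
      (u : rmod_hom X Y) (v : rmod_hom X' Y') :
      (forall t, v t = g (u (f t))) ->
      forall t, (P X' Y' v : ent_hom _ _) t = g ((P X Y u : ent_hom _ _) (f t)).
    move=> vE t.
    have -> : v = rmod_comp g (rmod_comp u f).
      by apply: rmod_hom_ext => s; rewrite vE.
    by have := congr1 (fun h : ent_hom _ _ => h t) (Pnat X X' Y Y' f g u).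
  exists (fun N : ent_module psi => P (cofree N) N (cofree_eps N)).
  split=> [M N f t|N n].
    (* Both sides are P of the map f (M ⊗ ε) = (N ⊗ ε)(f ⊗ C). *)
    transitivity ((P (cofree M) N (rmod_comp f (cofree_eps M)) : ent_hom _ _) t).
      exact/esym/(PnatE _ _ _ _ (ent_id (cofree M)) f).
    apply: (PnatE _ _ _ _ (cofree_map f) (ent_id N)) => {}t.
    change (f (cofree_eps_map M t) = cofree_eps_map N ((f \⊗ \id_C) t)).
    rewrite /cofree_eps_map !tensE; sweedler t m c.
    by rewrite !tensE linearZ_LR.
  (* Here (N ⊗ ε) ρ is the identity, which comes from an entwined morphism. *)
  transitivity ((P N N (rmod_id N) : ent_hom _ _) n).
    apply: esym; apply: (PnatE _ _ _ _ (coact_hom N) (ent_id N)) => {}n.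
    exact/esym/rcoact1.
  by rewrite [P N N _](PK N N (ent_id N)).
exists (fun (M N : ent_module psi) u =>
  ent_comp (nu N) (ent_comp (cofree_map u) (coact_hom M))).
split=> [X X' Y Y' f g u|X Y f]; apply: ent_hom_ext => m.
  transitivity (nu Y' ((g \⊗ \id_C) ((u \⊗ \id_C)
      ((f \⊗ \id_C) (rcoact X' m))))).
    by rewrite -!tmap_compl.
  by rewrite -nu_nat -ent_funP.
transitivity (nu Y ((f \⊗ \id_C) (rcoact X m))); first by [].
by rewrite -ent_funP nuK.
Qed.

(** * From an integral map to a retraction *)

Section RetractionFromIntegral.
Variable gamma : {linear C ⊗ C -> A}.
Hypothesis gamma_int : integral_map psi gamma.
Variable N : ent_module psi.

(** n ⊗ c goes to n_(0) γ(n_(1) ⊗ c). *)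
Definition integral_retraction_map : {linear N ⊗ C -> N} :=
  ract N \o (\id_N \⊗ gamma) \o tassoc \o (rcoact N \⊗ \id_C).

(** n_(0) a_(αβ) γ(n_(1)^β ⊗ c^α) = n_(0) γ(n_(1) ⊗ c) a, by the second integral
    condition. *)
Lemma integral_retraction_linear t a :
  integral_retraction_map (ract (cofree N) (t [⊗] a)) =
  ract N (integral_retraction_map t [⊗] a).
Proof.
rewrite ract_cofreeE /cofree_act /integral_retraction_map !tensE.
sweedler t n c; rewrite !tensE.
pose slide : {linear C ⊗ (A ⊗ C) -> A} :=
  amul A \o (\id_A \⊗ gamma) \o tassoc \o (psi \⊗ \id_C) \o tassocV.
transitivity (ract N ((\id_N \⊗ slide)
    (tassoc (rcoact N n [⊗] psi (c [⊗] a))))).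
  move: (psi _) => t; sweedler t a' c'; rewrite !tensE rcoact_psi.
  move: (rcoact N n) => t; sweedler t n0 n1; rewrite !tensE.
  move: (psi _) => t; sweedler t a'' c''.
  by rewrite !tensE ractA.
move: (rcoact N n) => t; sweedler t n0 n1; rewrite /slide !tensE.
have := gamma_int.2 (n1 [⊗] c [⊗] a); rewrite !tensE => <-.
by rewrite ractA.
Qed.

(** ρ(n_(0) γ(n_(1) ⊗ c)) = n_(0) ψ(n_(1) ⊗ γ(n_(2) ⊗ c)), which the first
    integral condition rewrites as n_(0) γ(n_(1) ⊗ c_(1)) ⊗ c_(2). *)
Lemma integral_retraction_colinear t :
  rcoact N (integral_retraction_map t) =
  (integral_retraction_map \⊗ \id_C) (rcoact (cofree N) t).
Proof.
rewrite rcoact_cofreeE /cofree_coact !tensE.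
rewrite {1}/integral_retraction_map; sweedler t n c; rewrite !tensE.
pose psi_gamma : {linear C ⊗ C ⊗ C -> A ⊗ C} := psi \o (\id_C \⊗ gamma) \o tassoc.
transitivity ((ract N \⊗ \id_C) (tassocV
    ((\id_N \⊗ (psi_gamma \o (comul C \⊗ \id_C))) (tassoc (rcoact N n [⊗] c))))).
  transitivity ((ract N \⊗ \id_C) (tassocV ((\id_N \⊗ psi_gamma)
      (tassoc (tassoc ((rcoact N \⊗ \id_C) (rcoact N n)) [⊗] c))))).
    move: (rcoact N n) => t; sweedler t n0 n1; rewrite !tensE rcoact_psi.
    move: (rcoact N n0) => t; sweedler t n0' n0''.
    by rewrite /psi_gamma !tensE.
  rewrite rcoactA; move: (rcoact N n) => t; sweedler t n0 n1.
  by rewrite /psi_gamma !tensE.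
transitivity ((ract N \⊗ \id_C) (tassocV
    ((\id_N \⊗ ((gamma \⊗ \id_C) \o tassocV)) (tassoc (rcoact N n [⊗] comul C c))))).
  move: (rcoact N n) => t; sweedler t n0 n1; rewrite /psi_gamma !tensE.
  by have := gamma_int.1 (n1 [⊗] c); rewrite !tensE => ->.
move: (comul C c) => t; sweedler t c1 c2; rewrite /integral_retraction_map !tensE.
move: (rcoact N n) => t; sweedler t n0 n1.
by rewrite !tensE.
Qed.

Definition integral_retraction : ent_hom (cofree N) N :=
  @EntHom k A C psi (cofree N) N
    (@RmodHom k A (cofree N) N integral_retraction_map integral_retraction_linear)
    integral_retraction_colinear.

End RetractionFromIntegral.

Lemma integral_retraction_natural gamma (gamma_int : integral_map psi gamma) :
  normalised gamma -> natural_retraction (integral_retraction gamma_int).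
Proof.
move=> gamma1; split=> [M N f t|N n].
  change (f (integral_retraction_map gamma M t) =
          integral_retraction_map gamma N ((f \⊗ \id_C) t)).
  rewrite /integral_retraction_map !tensE; sweedler t m c; rewrite !tensE ent_funP.
  move: (rcoact M m) => t; sweedler t m0 m1.
  by rewrite !tensE rmod_funP.
change (integral_retraction_map gamma N (rcoact N n) = n).
rewrite /integral_retraction_map !tensE rcoactA.
rewrite -[RHS]rcoact1; move: (rcoact N n) => t; sweedler t n0 n1.
by rewrite !tensE gamma1 tensZr linearZ_LR ract1.
Qed.

End Entwined.

(** * From a retraction to an integral map *)

Section TensL.
Variables (k : comPzRingType) (M N : lmodType k) (x : M).

(** A named copy of [tens x], to carry its linear structure. *)
Definition tensl (y : N) : M ⊗ N := x [⊗] y.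

Lemma tensl_linear : linear tensl.
Proof. exact: (tens_bilin M N).2. Qed.

HB.instance Definition _ :=
  GRing.isLinear.Build k N (M ⊗ N)%type *:%R tensl tensl_linear.

Lemma tenslE y : (tensl : {linear N -> M ⊗ N}) y = x [⊗] y.
Proof. by []. Qed.

End TensL.

Section RegHom.
Variables (k : comPzRingType) (A : algebra k).

Lemma lmul_linear (b a a' : A) :
  (amul A \o tensl b : {linear A -> A}) (ract (regular A) (a [⊗] a')) =
  ract (regular A) ((amul A \o tensl b : {linear A -> A}) a [⊗] a').
Proof. by rewrite !lin_compE !tenslE amulA. Qed.

Definition lmul (b : A) : rmod_hom (regular A) (regular A) :=
  @RmodHom k A (regular A) (regular A) (amul A \o tensl b) (lmul_linear b).

Lemma free_in_linear (V : lmodType k) (v : V) (a a' : A) :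
  (tensl v : {linear A -> V ⊗ A}) (ract (regular A) (a [⊗] a')) =
  ract (free A V) ((tensl v : {linear A -> V ⊗ A}) a [⊗] a').
Proof. by rewrite ract_freeE /free_act !tenslE !tensE. Qed.

Definition free_in (V : lmodType k) (v : V) : rmod_hom (regular A) (free A V) :=
  @RmodHom k A (regular A) (free A V)
    (tensl v : {linear A -> V ⊗ A}) (free_in_linear v).

End RegHom.

Section IntegralFromRetraction.
Variables (k : comPzRingType) (A : algebra k) (C : coalgebra k).
Variable psi : entwining A C.
Variable nu : forall N : ent_module psi, ent_hom (cofree psi N) N.
Hypothesis nu_nat : forall (M N : ent_module psi) (f : ent_hom M N) t,
     f (nu M t) = nu N ((f \⊗ \id_C) t).
Hypothesis nuK : forall (N : ent_module psi) n, nu N (rcoact N n) = n.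

(** The map θ(c ⊗ d) = ν_(A ⊗ C)(1 ⊗ c ⊗ d), which carries all the information
    about ν that γ needs. *)
Definition nu_unit : {linear C ⊗ C -> A ⊗ C} :=
  nu (cofree psi (regular A)) \o tassocV \o tensl (aone A).

Definition retraction_integral : {linear C ⊗ C -> A} :=
  cofree_eps_map C (regular A) \o nu_unit.

Lemma nu_unitE s :
  nu_unit s = nu (cofree psi (regular A)) (tassocV (aone A [⊗] s)).
Proof. by []. Qed.

(** On a cofree module, ν is determined by θ: an A-linear map g out of A is
    turned by the right adjoint into a morphism g ⊗ C, under which ν is natural.
    Used with N = A and N = C ⊗ A below. *)
Lemma nu_cofree (N : rmodule A) (g : rmod_hom (regular A) N) c d :
  nu (cofree psi N) (g (aone A) [⊗] c [⊗] d) = (g \⊗ \id_C) (nu_unit (c [⊗] d)).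
Proof.
rewrite nu_unitE [RHS](nu_nat (cofree_map psi g)); congr (nu _ _).
by rewrite !tensE.
Qed.

Lemma nu_cofree_regular (a : A) c d :
  nu (cofree psi (regular A)) (a [⊗] c [⊗] d) =
  (amul A \⊗ \id_C) (tassocV (a [⊗] nu_unit (c [⊗] d))).
Proof.
have := nu_cofree (lmul a) c d.
rewrite [lmul a _]/= amul1r => ->.
move: (nu_unit _) => t; sweedler t b c'.
by rewrite !tensE tenslE.
Qed.

Lemma nu_cofree_free c c' d :
  nu (cofree psi (free A C)) (c [⊗] aone A [⊗] c' [⊗] d) =
  tassocV (c [⊗] nu_unit (c' [⊗] d)).
Proof.
rewrite [LHS](nu_cofree (free_in A c)).
move: (nu_unit _) => t; sweedler t b d'.
by rewrite !tensE tenslE.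
Qed.

(** Δ(c) makes 1 ⊗ Δ(c) the coaction of 1 ⊗ c, so ν being a retraction applies. *)
Lemma nu_unit_comul c : nu_unit (comul C c) = aone A [⊗] c.
Proof.
have := nuK (N := cofree psi (regular A)) (aone A [⊗] c).
by rewrite rcoact_cofreeE /cofree_coact nu_unitE !tensE.
Qed.

(** θ(c ⊗ d) = γ(c ⊗ d_(1)) ⊗ d_(2): colinearity of ν says that (A ⊗ Δ) θ(c ⊗ d)
    is θ(c ⊗ d_(1)) ⊗ d_(2), and A ⊗ ε ⊗ C removes the extra factor. *)
Lemma nu_unit_colinear s :
  nu_unit s = (retraction_integral \⊗ \id_C) (tassocV ((\id_C \⊗ comul C) s)).
Proof.
have /(congr1 (cofree_eps_map C (regular A) \⊗ \id_C)) :
    cofree_coact C (regular A) (nu_unit s) =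
    (nu_unit \⊗ \id_C) (tassocV ((\id_C \⊗ comul C) s)).
  have := ent_funP (nu (cofree psi (regular A))) (tassocV (aone A [⊗] s)).
  rewrite rcoact_cofreeE nu_unitE => ->; rewrite rcoact_cofreeE {1}/cofree_coact.
  sweedler s c d; rewrite !tensE.
  move: (comul C d) => t; sweedler t d1 d2.
  by rewrite /nu_unit !tensE.
move=> e; rewrite [RHS](tmap_compl _ nu_unit) -e {e}.
move: (nu_unit s) => t; rewrite /cofree_coact.
sweedler t a c; rewrite !tensE -[in LHS](counitl c).
move: (comul C c) => t; sweedler t c1 c2.
by rewrite /cofree_eps_map !tensE tensZr tensZl.
Qed.

(** The counit recovers ν_(C ⊗ A)(c ⊗ 1 ⊗ d) from its coaction, and naturality
    under the coaction C ⊗ A -> C ⊗ A ⊗ C moves the computation to a cofree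
    module, where [nu_cofree] gives c_(1) ⊗ θ(c_(2) ⊗ d). *)
Lemma nu_free_entwined c d :
  nu (free_entwined psi) (c [⊗] aone A [⊗] d) =
  (\id_C \⊗ retraction_integral) (tassoc (comul C c [⊗] d)).
Proof.
rewrite -[LHS](rcoact1 (e := free_entwined psi)).
rewrite [rcoact _ _](nu_nat (coact_hom (free_entwined psi))).
transitivity (cofree_eps_map C (free A C)
  (tassocV ((\id_C \⊗ nu_unit) (tassoc (comul C c [⊗] d))))).
  congr (tunitr (tmap _ _ _)).
  transitivity (nu (cofree psi (free A C)) (free_coact psi (c [⊗] aone A) [⊗] d)).
    by rewrite tensE.
  rewrite /free_coact !tensE.
  move: (comul C c) => t; sweedler t c1 c2.
  by rewrite !tensE entw_one tassocVE nu_cofree_free nu_unitE !tensE.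
rewrite /cofree_eps_map; move: (comul C c) => t; sweedler t c1 c2; rewrite !tensE.
move: (nu _ _) => t; sweedler t a c'.
by rewrite !tensE tensZr.
Qed.

(** Since ψ(c ⊗ 1) = 1 ⊗ c, naturality of ν under ψ computes θ from
    [nu_free_entwined]. *)
Lemma nu_unit_entw c d :
  nu_unit (c [⊗] d) = psi ((\id_C \⊗ retraction_integral) (tassoc (comul C c [⊗] d))).
Proof.
transitivity (nu (cofree psi (regular A)) (psi (c [⊗] aone A) [⊗] d)).
  by rewrite nu_unitE tassocVE entw_one.
by rewrite -nu_free_entwined [RHS](nu_nat (entw_hom psi)) tensE.
Qed.

(** The first condition compares the two computations of θ.  For the second,
    γ(c ⊗ d) a is obtained by applying A ⊗ ε to
    θ(c ⊗ d) a = ν((1 ⊗ c ⊗ d) a) = ν(a_(αβ) ⊗ c^β ⊗ d^α) = a_(αβ) θ(c^β ⊗ d^α). *)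
Lemma retraction_integralP : integral_map psi retraction_integral.
Proof.
split=> t.
  by rewrite -nu_unit_colinear; sweedler t c d; rewrite nu_unit_entw !tensE.
sweedler t s a; sweedler s c d; rewrite !tensE.
transitivity (cofree_eps_map C (regular A) (nu (cofree psi (regular A))
    (ract (cofree psi (cofree psi (regular A))) (aone A [⊗] c [⊗] d [⊗] a)))).
  by rewrite rmod_funP [RHS]cofree_eps_linear /retraction_integral /nu_unit !tensE.
rewrite ract_cofreeE /cofree_act !tensE.
move: (psi (d [⊗] a)) => t; sweedler t a' d'; rewrite !tensE.
move: (psi (c [⊗] a')) => t; sweedler t b c'; rewrite !tensE.
rewrite amul1l nu_cofree_regular nu_unitE tassocVE.
move: (nu _ _) => t; rewrite /cofree_eps_map; sweedler t b' e.
by rewrite !tensE tensZr linearZ_LR.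
Qed.

Lemma retraction_integral_normalised : normalised retraction_integral.
Proof.
by move=> c; rewrite /retraction_integral lin_compE nu_unit_comul /cofree_eps_map !tensE.
Qed.

End IntegralFromRetraction.

Theorem theorem5p2 (k : comPzRingType) (A : algebra k) (C : coalgebra k)
    (psi : entwining A C) :
  separable (forgetful psi) <->
  exists gamma : {linear C ⊗ C -> A},
    integral_map psi gamma /\ normalised gamma.
Proof.
rewrite separable_retraction.
split=> [[nu [nu_nat nuK]]|[gamma [gamma_int gamma1]]].
  exists (retraction_integral nu); split; first exact: retraction_integralP.
  exact: retraction_integral_normalised.
exists (integral_retraction gamma_int); exact: integral_retraction_natural.
Qed.
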